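(* Consider $w\in\mathfrak{S}_n$, with the weak order on $\mathfrak{S}_n$, and let $T$ be the support of $w$. Then $[\sigma,w]_{\mathrm{wk}}$ is boolean for all $\sigma\in T$ (in particular, $\sigma\le_{\mathrm{wk}}w$ for all $\sigma\in T$) if and only if $w$ is free; i.e., if and only if the principal order ideal $\{u: u\le_{\mathrm{wk}}w\}$ is boolean.
   Context: $\mathfrak{S}_n$ is the symmetric group with Coxeter generators $\sigma_1,\dots,\sigma_{n-1}$, where $\sigma_i$ is the transposition swapping $i$ and $i+1$. A reduced decomposition of $w$ is a word of minimal length in these generators with product $w$. The support of $w$ is the set of generators appearing in reduced decompositions of $w$. (Right) weak order: $v\le_{\mathrm{wk}}w$ if some reduced decomposition of $v$ is a prefix of a reduced decomposition of $w$. $[v,w]_{\mathrm{wk}}=\{u: v\le_{\mathrm{wk}}u\le_{\mathrm{wk}}w\}$; if $v\not\le_{\mathrm{wk}}w$ there is no such interval and it is not considered boolean. A permutation is free if it is a (possibly empty) product of pairwise commuting generators (equivalently, it avoids the patterns $231$, $312$, $321$). A poset is boolean if it is isomorphic to the poset of all subsets of a finite set, ordered by inclusion. *)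

(* Defs.v *)
From mathcomp Require Import all_boot all_fingroup.

Set Implicit Arguments.
Unset Strict Implicit.
Unset Printing Implicit Defensive.

Local Open Scope group_scope.

Lemma ltn_ord_pred n (i : 'I_n.-1) : i < n.
Proof. by case: n i => [[]|n i] //; rewrite ltnW // ltnS ltn_ord. Qed.

Lemma ltn_ord_predS n (i : 'I_n.-1) : i.+1 < n.
Proof. by case: n i => [[]|n i] //; rewrite ltnS ltn_ord. Qed.

(* Points are numbered from 0: simple_transp i swaps i and i+1 in {0,..,n-1}, *)
(* for 0 <= i < n-1.                                                          *)
Definition simple_transp n (i : 'I_n.-1) : 'S_n :=
  tperm (Ordinal (ltn_ord_pred i)) (Ordinal (ltn_ord_predS i)).

(* The product of {perm T} composes from left to right; reversing the word    *)
(* makes [:: i1; ..; il] denote the usual composite s_i1 o .. o s_il, so that *)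
(* the prefix order below is the right weak order.                            *)
Definition word_perm n (s : seq 'I_n.-1) : 'S_n :=
  \prod_(i <- rev s) simple_transp i.

Definition reduced_decomp n (w : 'S_n) (s : seq 'I_n.-1) : Prop :=
  word_perm s = w /\ forall t, word_perm t = w -> size s <= size t.

Definition in_support n (w sigma : 'S_n) : Prop :=
  exists2 s, reduced_decomp w s & sigma \in [seq simple_transp i | i <- s].

Definition weak_le n (v w : 'S_n) : Prop :=
  exists s t, [/\ reduced_decomp v s, reduced_decomp w t & prefix s t].

Definition weak_interval n (v w u : 'S_n) : Prop :=
  weak_le v u /\ weak_le u w.

Definition weak_ideal n (w u : 'S_n) : Prop := weak_le u w.

(* The subposet {x | P x} of (T, le) is isomorphic to ({set I}, \subset).     *)
Definition boolean_subposet (T : Type) (le : T -> T -> Prop) (P : T -> Prop) :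
    Prop :=
  exists (I : finType) (f : {set I} -> T),
    [/\ injective f,
        forall x, P x <-> exists A, f A = x
      & forall A B : {set I}, A \subset B <-> le (f A) (f B)].

Definition boolean_weak_interval n (v w : 'S_n) : Prop :=
  weak_le v w /\ boolean_subposet (@weak_le n) (weak_interval v w).

Definition free_perm n (w : 'S_n) : Prop :=
  exists2 s : seq 'I_n.-1,
    {in s &, forall i j, commute (simple_transp i) (simple_transp j)}
    & w = word_perm s.

(* Main.v *)
(** A free w is a product of a set J of commuting generators, its reduced words
   are the enumerations of J, and K |-> (product of K) identifies the subsets of
   J with the elements below w.  Conversely, if two adjacent generators s, t of
   the support lie below w, then so does sts, because the inverse of w has two
   consecutive descents.  The elements between s and sts form the chain
   s < st < sts, whereas a Boolean order has a relative complement of st there.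
   If the whole ideal of w is Boolean, its maximal chain shows that it has at
   least as many atoms as a reduced word of w has letters; every atom is one of
   these letters, so all of them lie below w and the previous argument
   applies. *)

Require Import Defs.
From mathcomp Require Import all_boot all_fingroup.

Set Implicit Arguments.
Unset Strict Implicit.
Unset Printing Implicit Defensive.

Local Open Scope group_scope.

(** * Words and the letters they cannot avoid *)

Section Words.
Variable n : nat.
Implicit Types (i j k : 'I_n.-1) (s t r : seq 'I_n.-1) (u v w x : 'S_n).

Let lo i : 'I_n := Ordinal (ltn_ord_pred i).
Let hi i : 'I_n := Ordinal (ltn_ord_predS i).

Lemma word_perm_nil : word_perm [::] = 1 :> 'S_n.
Proof. by rewrite /word_perm big_nil. Qed.

(** The factors come in reverse order, so deleting a first letter [i] is right multiplication by
    [simple_transp i]. *)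
Lemma word_perm_cat s t : word_perm (s ++ t) = word_perm t * word_perm s.
Proof. by rewrite /word_perm rev_cat big_cat. Qed.

Lemma word_perm1 i : word_perm [:: i] = simple_transp i.
Proof. by rewrite /word_perm big_seq1. Qed.

Lemma word_perm_cons i s : word_perm (i :: s) = word_perm s * simple_transp i.
Proof. by rewrite -cat1s word_perm_cat word_perm1. Qed.

Lemma simple_transp_sq i : simple_transp i * simple_transp i = 1.
Proof. exact: tperm2. Qed.

Lemma simple_transp_le i j (a : 'I_n) :
  i != j -> (simple_transp i a <= j) = (a <= j).
Proof.
move=> ij; rewrite /simple_transp; case: tpermP => [->|->|] //=.
  by rewrite (leq_eqVlt i) -[nat_of_ord i == j]/(i == j) (negPf ij).
by rewrite (leq_eqVlt i) -[nat_of_ord i == j]/(i == j) (negPf ij).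
Qed.

(** Only the letter [j] moves points across the cut between [j] and [j.+1]. *)
Lemma word_perm_le j s (a : 'I_n) :
  j \notin s -> (word_perm s a <= j) = (a <= j).
Proof.
elim: s a => [|i s IHs] a; first by rewrite word_perm_nil perm1.
rewrite inE negb_or => /andP[ji js].
by rewrite word_perm_cons permM simple_transp_le ?IHs // eq_sym.
Qed.

(** Split [s] at its single [j]. The point that the part after [j] sends to [lo j] starts below the
    cut at [j] and ends above it, which is impossible for a word without [j]. *)
Lemma uniq_word_perm_subset s t :
  uniq s -> word_perm s = word_perm t -> {subset s <= t}.
Proof.
move=> us st j js; apply: contraT => jt.
case/splitPr: js us st => s1 s2.
rewrite cat_uniq /= => /and3P[_ /norP[js1 _] /andP[js2 _]] st.
have := word_perm_le ((word_perm s2)^-1 (lo j)) jt.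
rewrite -st word_perm_cat word_perm_cons !permM permKV word_perm_le //.
rewrite -(word_perm_le ((word_perm s2)^-1 (lo j)) js2) permKV tpermL /=.
by rewrite ltnn leqnn.
Qed.

Lemma uniq_reduced_decomp s : uniq s -> reduced_decomp (word_perm s) s.
Proof.
move=> us; split=> // t st; apply: (uniq_leq_size us).
exact: uniq_word_perm_subset us (esym st).
Qed.

(** All letters of [s] occur in [t], and [t] is no longer than [s], so there is no room for a
    repetition or a new letter. *)
Lemma uniq_reduced_perm_eq s t :
  uniq s -> reduced_decomp (word_perm s) t -> perm_eq s t.
Proof.
move=> us [st lt]; have sub := uniq_word_perm_subset us (esym st).
have le_ts := lt _ erefl.
by apply: uniq_perm; rewrite ?(leq_size_uniq us sub) //; have [] := uniq_min_size us sub le_ts.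
Qed.

(** * Length and inversions *)

Definition inversions x : {set 'I_n * 'I_n} :=
  [set p : 'I_n * 'I_n | (p.1 < p.2) && (x p.2 < x p.1)].

(* The inverse makes left descents of [w] visible as position descents of
   [w^-1], which is what a first letter of a reduced word removes. *)
Definition inv_length w := #|inversions w^-1|.

Lemma simple_transp_lt i (a b : 'I_n) :
  (a, b) != (lo i, hi i) -> (a, b) != (hi i, lo i) ->
  (simple_transp i a < simple_transp i b) = (a < b).
Proof.
have lohi (c : 'I_n) : c <> lo i -> c <> hi i -> (c != i :> nat) * (c != i.+1 :> nat).
  by move=> cl ch; split; apply/eqP => ci; [apply: cl | apply: ch]; apply: val_inj.
rewrite /simple_transp.
case: tpermP => [->|->|/lohi{}lohi1 /lohi1[a1 a2]];
  case: tpermP => [->|->|/lohi{}lohi2 /lohi2[b1 b2]];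
  rewrite ?eqxx //= ?ltnn // => _ _.
- by rewrite ltn_neqAle eq_sym b2.
- by rewrite [RHS]ltn_neqAle eq_sym b2.
- by rewrite ltnS leq_eqVlt (negPf a1).
- by rewrite ltnS [RHS]leq_eqVlt (negPf a1).
Qed.

(** Relabelling positions by [simple_transp i] matches the inversions of both permutations, except
    that the pair [(lo i, hi i)] becomes a new one. *)
Lemma card_inversionsM i x :
  x (lo i) < x (hi i) -> #|inversions (simple_transp i * x)| = #|inversions x|.+1.
Proof.
move=> xi; have xiF : (x (hi i) < x (lo i)) = false by rewrite ltnNge (ltnW xi).
pose phi (p : 'I_n * 'I_n) := (simple_transp i p.1, simple_transp i p.2).
have phi_inj : injective phi by move=> [a b] [c d] [/perm_inj-> /perm_inj->].
have -> : inversions (simple_transp i * x) = (lo i, hi i) |: phi @^-1: inversions x.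
  apply/setP => -[a b]; rewrite !inE /= !permM.
  have [[-> ->]|ne1] := eqVneq (a, b) (lo i, hi i).
    by rewrite /simple_transp tpermL tpermR xi /= ltnS leqnn.
  have [[-> ->]|ne2] := eqVneq (a, b) (hi i, lo i).
    by rewrite /simple_transp tpermL tpermR xiF !andbF.
  by rewrite simple_transp_lt.
rewrite cardsU1 card_preimset // !inE /= /simple_transp tpermL tpermR /=.
by rewrite ltnNge leqnSn.
Qed.

Lemma inv_lengthM i w :
  w^-1 (lo i) < w^-1 (hi i) -> inv_length (w * simple_transp i) = (inv_length w).+1.
Proof. by move=> wi; rewrite /inv_length invMg tpermV card_inversionsM. Qed.

Lemma inv_lengthM_desc i w :
  w^-1 (hi i) < w^-1 (lo i) -> inv_length w = (inv_length (w * simple_transp i)).+1.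
Proof.
move=> wi; rewrite -(@inv_lengthM i) -?mulgA ?simple_transp_sq ?mulg1 //.
by rewrite invMg tpermV !permM tpermL tpermR.
Qed.

Lemma inv_length1 : inv_length 1 = 0.
Proof.
apply/eqP; rewrite /inv_length invg1 cards_eq0; apply/eqP/setP => -[a b].
by rewrite !inE /= !perm1; case: ltngtP.
Qed.

Lemma inv_length_word s : inv_length (word_perm s) <= size s.
Proof.
elim: s => [|i s IHs]; first by rewrite word_perm_nil inv_length1.
rewrite word_perm_cons /=; set w := word_perm s in IHs *.
have [/inv_lengthM->//|/inv_lengthM_desc|] := ltngtP (w^-1 (lo i)) (w^-1 (hi i)).
  by move=> e; rewrite e in IHs; do 2!apply: ltnW.
by move/val_inj/perm_inj/(congr1 val) => /= /n_Sn.
Qed.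

Lemma perm_mono_ge x :
  {homo x : a b / (a < b)%N} -> forall a : 'I_n, a <= x a.
Proof.
move=> x_mono [m]; elim: m => // m IHm ltm /=.
have := x_mono (Ordinal (ltnW ltm)) (Ordinal ltm) (ltnSn m).
exact: leq_ltn_trans (IHm (ltnW ltm)).
Qed.

(** Without descents, [x] and its inverse are both increasing, so neither moves a point down; this
    leaves only the identity. *)
Lemma exists_descent x : x != 1 -> exists i, x (hi i) < x (lo i).
Proof.
move=> x1; apply/existsP; apply: contraR x1 => /existsPn asc.
have x_mono : {homo x : a b / (a < b)%N}.
  move=> a [m]; elim: m => // m IHm ltm; rewrite ltnS => lea.
  have ltm' : m < n.-1 by rewrite -ltnS (ltn_predK ltm).
  have : x (lo (Ordinal ltm')) < x (hi (Ordinal ltm')).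
    rewrite ltn_neqAle leqNgt asc andbT; apply/eqP.
    by move/val_inj/perm_inj/(congr1 val) => /= /n_Sn.
  have -> : hi (Ordinal ltm') = Ordinal ltm by apply: val_inj.
  have [am|nam] := eqVneq (nat_of_ord a) m.
    by rewrite (_ : lo _ = a) //; apply: val_inj.
  apply: ltn_trans; rewrite (_ : lo _ = Ordinal (ltnW ltm)); last exact: val_inj.
  by apply: IHm; rewrite /= ltn_neqAle nam.
have xV_mono : {homo x^-1 : a b / (a < b)%N}.
  move=> a b ab; rewrite ltnNge leq_eqVlt; apply/norP; split.
    by apply/eqP => /val_inj/perm_inj ba; rewrite ba ltnn in ab.
  by apply/negP => /x_mono; rewrite !permKV ltnNge (ltnW ab).
apply/eqP/permP => a; apply/val_inj/eqP; rewrite perm1 eqn_leq (perm_mono_ge x_mono) andbT.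
by have := perm_mono_ge xV_mono (x a); rewrite permK.
Qed.

(** Bubble sort: each descent of [w^-1] gives a first letter whose removal costs exactly one
    inversion. *)
Lemma exists_word w : exists2 s, word_perm s = w & size s = inv_length w.
Proof.
have [m] := ubnP (inv_length w); elim: m w => // m IHm w lem.
have [->|w1] := eqVneq w 1.
  by exists [::]; rewrite ?word_perm_nil ?inv_length1.
have [|i] := @exists_descent w^-1.
  by apply: contra w1 => /eqP e; rewrite -(invgK w) e invg1.
move/inv_lengthM_desc => e; rewrite e in lem *.
have [s sw <-] := IHm _ lem; exists (i :: s) => //.
by rewrite word_perm_cons sw -mulgA simple_transp_sq mulg1.
Qed.

Lemma reduced_decompP w s :
  reduced_decomp w s <-> word_perm s = w /\ size s = inv_length w.
Proof.
split=> [[sw mins]|[sw ss]]; split=> //.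
  have [t tw ts] := exists_word w.
  by apply/eqP; rewrite eqn_leq -{1}ts mins //= -sw inv_length_word.
by move=> t tw; rewrite ss -tw inv_length_word.
Qed.

Lemma exists_reduced w : exists s, reduced_decomp w s.
Proof. by have [s] := exists_word w; exists s; apply/reduced_decompP. Qed.

Lemma reduced_prefix w s t :
  reduced_decomp w (s ++ t) -> reduced_decomp (word_perm s) s.
Proof.
case=> <- mins; split=> // r rs; rewrite -(leq_add2r (size t)) -!size_cat.
by apply: mins; rewrite !word_perm_cat rs.
Qed.

Lemma weak_le_prefix w s t : reduced_decomp w (s ++ t) -> weak_le (word_perm s) w.
Proof.
by move=> red; exists s, (s ++ t); rewrite prefix_prefix; split=> //; apply: reduced_prefix red.
Qed.

(** The order only provides some reduced word of [v] as a prefix. Any other one can take its place,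
    since the product and the length of the whole word do not change. *)
Lemma weak_le_extend v w s :
  weak_le v w -> reduced_decomp v s -> exists t, reduced_decomp w (s ++ t).
Proof.
move=> [s' [t' [/reduced_decompP[<- ls'] /reduced_decompP[<- lt] /prefixP[t deft]]]].
move=> /reduced_decompP[ws ls]; exists t; rewrite {}deft in lt *.
apply/reduced_decompP; rewrite -lt !word_perm_cat ws; split=> //.
by rewrite !size_cat ls ls'.
Qed.

Lemma weak_le_refl w : weak_le w w.
Proof. by have [s red] := exists_reduced w; exists s, s; rewrite prefix_refl. Qed.

Lemma weak_le1 w : weak_le 1 w.
Proof.
by have [s red] := exists_reduced w; rewrite -word_perm_nil; apply: (@weak_le_prefix w [::] s).
Qed.

Lemma weak_le_trans v u w : weak_le u v -> weak_le v w -> weak_le u w.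
Proof.
move=> [s [t [rs rt /prefixP[r dt]]]] vw; have [r'] := weak_le_extend vw rt.
rewrite dt -catA => red; exists s, (s ++ (r ++ r')).
by rewrite prefix_prefix.
Qed.

(** Deleting the first letter [i] of a reduced word leaves a word for [w * simple_transp i] shorter
    than [inv_length w], whereas an ascent would make that product longer than [w]. *)
Lemma weak_le_simple i w :
  weak_le (simple_transp i) w -> w^-1 (hi i) < w^-1 (lo i).
Proof.
have red1 : reduced_decomp (simple_transp i) [:: i].
  by rewrite -word_perm1; apply: uniq_reduced_decomp.
move=> /weak_le_extend/(_ red1)[t /reduced_decompP[ws ls]].
have [wi|//|/val_inj/perm_inj/(congr1 val) /= /n_Sn//] := ltngtP (w^-1 (lo i)) (w^-1 (hi i)).
have := inv_length_word t.
have -> : word_perm t = w * simple_transp i.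
  by rewrite -ws word_perm_cons -mulgA simple_transp_sq mulg1.
by rewrite inv_lengthM // -ls /= => /ltnW; rewrite ltnn.
Qed.

Lemma weak_le_simple_mem i w s :
  weak_le (simple_transp i) w -> word_perm s = w -> i \in s.
Proof.
move=> /weak_le_simple wi sw; apply: contraT => /word_perm_le ws.
have := ws (w^-1 (lo i)); have := ws (w^-1 (hi i)).
rewrite sw !permKV /= ltnn leqnn => hiF loT.
by move: wi; rewrite ltnNge (leq_trans (esym loT)) // ltnW // ltnNge -hiF.
Qed.

(** [w^-1] decreases along the three points [lo i], [hi i], [hi j]. Reversing them takes the
    adjacent swaps [i], [j], [i], each of which removes one inversion. *)
Lemma reduced_braid i j w :
  j = i.+1 :> nat -> weak_le (simple_transp i) w -> weak_le (simple_transp j) w ->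
  exists r, reduced_decomp w ([:: i; j; i] ++ r).
Proof.
move=> ji /weak_le_simple wi /weak_le_simple wj.
have lohi : lo j = hi i by apply: val_inj.
rewrite lohi in wj.
have nel : hi j != lo i by rewrite -val_eqE /= ji -addn2 -{2}[nat_of_ord i]addn0 eqn_add2l.
have neh : hi j != hi i by rewrite -val_eqE /= ji -addn1 -{2}[i.+1]addn0 eqn_add2l.
have nlh : lo i != hi i by rewrite -val_eqE /= neq_ltn ltnSn.
have e1 : inv_length w = (inv_length (w * simple_transp i)).+1.
  exact: inv_lengthM_desc.
have sji : simple_transp j (lo i) = lo i.
  by apply: tpermD => //; have := nlh; rewrite eq_sym -lohi.
have sij : simple_transp i (hi j) = hi j by apply: tpermD; rewrite eq_sym.
have e2 : inv_length (w * simple_transp i)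
    = (inv_length (w * simple_transp i * simple_transp j)).+1.
  by apply: inv_lengthM_desc; rewrite lohi invMg tpermV !permM tpermR sij (ltn_trans wj).
have e3 : inv_length (w * simple_transp i * simple_transp j)
    = (inv_length (w * simple_transp i * simple_transp j * simple_transp i)).+1.
  by apply: inv_lengthM_desc; rewrite !invMg !tpermV !permM -lohi tpermL sij sji tpermL.
have [r rw rl] := exists_word (w * simple_transp i * simple_transp j * simple_transp i).
exists r; apply/reduced_decompP; rewrite size_cat rl e1 e2 e3; split=> //.
rewrite word_perm_cat rw !word_perm_cons word_perm_nil mul1g.
have sK k x : simple_transp k * (simple_transp k * x) = x.
  by rewrite mulgA simple_transp_sq mul1g.
by rewrite -!mulgA !sK simple_transp_sq mulg1.
Qed.

(** * From Boolean intervals to free permutations *)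

Lemma commute_nonadjacent i j :
  j != i.+1 :> nat -> i != j.+1 :> nat -> commute (simple_transp i) (simple_transp j).
Proof.
move=> ji ij; have [->//|nij] := eqVneq i j; apply/commgP/conjg_fixP.
by rewrite tpermJ !tpermD // -val_eqE /= ?eqSS 1?eq_sym.
Qed.

(** A reduced word through [u] has the form [i :: r1 ++ r2]. Cancelling [i] leaves two letters with
    the product of [[:: j; i]], which must be that very word, so the length of [r1] determines
    [u]. *)
Lemma weak_between_braid i j u :
    reduced_decomp (word_perm [:: i; j; i]) [:: i; j; i] ->
    weak_le (word_perm [:: i]) u -> weak_le u (word_perm [:: i; j; i]) ->
  [\/ u = word_perm [:: i], u = word_perm [:: i; j] | u = word_perm [:: i; j; i]].
Proof.
move=> red iu uw.
have nij : i != j.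
  apply: contraPneq red => <- [_ /(_ [:: i])].
  by rewrite !word_perm_cons word_perm_nil mul1g simple_transp_sq mul1g => /(_ erefl).
have redi : reduced_decomp (word_perm [:: i]) [:: i] by apply: uniq_reduced_decomp.
have [r1 redu] := weak_le_extend iu redi.
have [r2] := weak_le_extend uw redu; rewrite -catA /= => redw.
have rE : word_perm [:: j; i] = word_perm (r1 ++ r2).
  by apply: (mulIg (simple_transp i)); rewrite -!word_perm_cons; case: redw => <-.
have us : uniq [:: j; i] by rewrite /= inE eq_sym nij.
have sub := uniq_word_perm_subset us rE.
have sz : size (r1 ++ r2) = 2.
  move/reduced_decompP: red => [_]; move/reduced_decompP: redw => [_ <-].
  by case.
have {redw sz sub}rE2 : r1 ++ r2 = [:: j; i].
  have := sub j; have := sub i; rewrite !inE !eqxx orbT.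
  case: (r1 ++ r2) sz redw => [|a [|b [|]]] //= _ [wE minw].
  rewrite !inE => /(_ isT) ii /(_ isT) jj.
  have [ia|nia] := eqVneq i a; last first.
    move: ii jj; rewrite (negPf nia) /= => /eqP <-.
    by rewrite [j == i]eq_sym (negPf nij) orbF => /eqP->.
  (* A word starting with [i], [i] would shorten to its last letter. *)
  have := minw [:: b]; rewrite -wE -ia !word_perm_cons -!mulgA simple_transp_sq mulg1.
  by move/(_ erefl).
case: r1 r2 {rE} rE2 redu => [|a [|b [|c r1]]] r2 //=.
- by move=> _ [<- _]; constructor 1.
- by case=> -> _ [<- _]; constructor 2.
- by case=> -> -> _ [<- _]; constructor 3.
Qed.

(** [P] stays general so as to cover both the intervals above a generator and the whole ideal. *)
Lemma boolean_braid_false (P : 'S_n -> Prop) i j :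
    reduced_decomp (word_perm [:: i; j; i]) [:: i; j; i] ->
    boolean_subposet (@weak_le n) P ->
    P (word_perm [:: i]) -> P (word_perm [:: i; j]) -> P (word_perm [:: i; j; i]) ->
  False.
Proof.
move=> red [I [f [_ imf fle]]] /imf[A0 f0] /imf[A1 f1] /imf[A2 f2].
have [red2 red1] := (@reduced_prefix _ [:: i; j] [:: i] red, @reduced_prefix _ [:: i] [:: j; i] red).
have strict s t : reduced_decomp (word_perm s) s -> reduced_decomp (word_perm t) t ->
    size s < size t -> ~ weak_le (word_perm t) (word_perm s).
  move=> /reduced_decompP[_ ls] redt lt_st /weak_le_extend/(_ redt)[r] /reduced_decompP[_].
  by rewrite -ls size_cat => e; rewrite -e ltnNge leq_addr in lt_st.
have A01 : A0 \subset A1.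
  by apply/fle; rewrite f0 f1; apply: (@weak_le_prefix _ [:: i] [:: j]).
have A12 : A1 \subset A2.
  by apply/fle; rewrite f1 f2; apply: (@weak_le_prefix _ [:: i; j] [:: i]).
have A10 : ~ A1 \subset A0 by move/fle; rewrite f0 f1; apply: strict.
have A21 : ~ A2 \subset A1 by move/fle; rewrite f1 f2; apply: strict.
(* The relative complement of [A1] in the Boolean interval between [A0] and
   [A2] has to be one of the three elements of the chain. *)
pose B := A2 :\: (A1 :\: A0).
have A0B : A0 \subset B.
  apply/subsetP => x x0; rewrite !inE x0 /=.
  by rewrite (subsetP A12) // (subsetP A01).
have BA2 : B \subset A2 by apply: subsetDl.
(* The value [f A0] would put [A2] inside [A1]; each of the other two would put [A1] inside [A0]. *)
have [] := @weak_between_braid i j (f B) red.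
- by rewrite -f0; apply/fle.
- by rewrite -f2; apply/fle.
- rewrite -f0 => fB; have /fle/subsetP BA0 : weak_le (f B) (f A0).
    by rewrite fB; apply: weak_le_refl.
  apply: A21; apply/subsetP => x x2; have := BA0 x; rewrite !inE x2 andbT.
  have := subsetP A01 x.
  by case: (x \in A0) (x \in A1) => [] [] //= => [/(_ isT)|_ /(_ isT)].
- rewrite -f1 => fB; have /fle/subsetP A1B : weak_le (f A1) (f B).
    by rewrite fB; apply: weak_le_refl.
  by apply: A10; apply/subsetP => x x1; have := A1B x x1; rewrite !inE x1 andbT negbK => /andP[].
- rewrite -f2 => fB; have /fle/subsetP A2B : weak_le (f A2) (f B).
    by rewrite fB; apply: weak_le_refl.
  apply: A10; apply/subsetP => x x1; have := A2B x (subsetP A12 x x1).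
  by rewrite !inE x1 andbT negbK => /andP[].
Qed.

(** The set [P] may depend on the letter: it is the interval above that letter in one application
    and the ideal of [w] in the other. *)
Lemma free_perm_of_boolean w s :
    reduced_decomp w s ->
    (forall i, i \in s -> weak_le (simple_transp i) w /\
      exists2 P : 'S_n -> Prop, boolean_subposet (@weak_le n) P
        & forall u, weak_le (simple_transp i) u -> weak_le u w -> P u) ->
  free_perm w.
Proof.
move=> red bool_s; have [sw _] := red; exists s => // i j si sj.
have no_adj k l : k \in s -> l \in s -> l = k.+1 :> nat -> False.
  move=> /bool_s[kw [P boolP Pu]] /bool_s[lw _] lk.
  have [r redw] := reduced_braid lk kw lw.
  have red3 := reduced_prefix redw.
  (* All nonempty prefixes of [[:: k; l; k]] lie between [simple_transp k] and [w], hence in [P]. *)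
  have Pt t t' : [:: k] ++ t ++ t' = [:: k; l; k] -> P (word_perm ([:: k] ++ t)).
    move=> tE; apply: Pu.
      rewrite -word_perm1; apply: weak_le_prefix (t) _.
      by apply: (@reduced_prefix _ _ t'); rewrite -catA tE; apply: red3.
    by apply: (@weak_le_prefix _ _ (t' ++ r)); rewrite -catA (catA t) catA tE.
  exact: (boolean_braid_false red3 boolP (Pt [::] [:: l; k] erefl)
    (Pt [:: l] [:: k] erefl) (Pt [:: l; k] [::] erefl)).
by apply: commute_nonadjacent; apply/eqP => /no_adj; apply.
Qed.

(** * Products of commuting generators *)

Lemma commute_word i s :
  {in s, forall j, commute (simple_transp i) (simple_transp j)} ->
  commute (simple_transp i) (word_perm s).
Proof.
elim: s => [|j s IHs] comm; first by rewrite word_perm_nil; apply: commute1.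
rewrite word_perm_cons; apply: commuteM; last by apply: comm; rewrite mem_head.
by apply: IHs => k ks; apply: comm; rewrite inE ks orbT.
Qed.

Definition commuting (A : {pred 'I_n.-1}) :=
  {in A &, forall i j, commute (simple_transp i) (simple_transp j)}.

Lemma commuting_word_perm s t :
  commuting (mem s) -> perm_eq s t -> word_perm s = word_perm t.
Proof.
elim: s t => [|i s IHs] t comm pst.
  by move: pst; rewrite perm_sym => /perm_nilP->.
have it : i \in t by rewrite -(perm_mem pst) mem_head.
case/splitPr: it pst => t1 t2; rewrite perm_sym perm_catC /= perm_cons perm_catC perm_sym.
move=> pst; rewrite word_perm_cons (IHs _ _ pst); last first.
  by move=> j k js ks; apply: comm; rewrite inE ?js ?ks orbT.
rewrite !word_perm_cat word_perm_cons -!mulgA; congr (_ * _).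
apply/esym/commute_word => j jt1; apply: comm; rewrite inE ?eqxx //.
by rewrite (perm_mem pst) mem_cat jt1 orbT.
Qed.

(** The word in [free_perm] may repeat letters; commuting involutions cancel in pairs. *)
Lemma commuting_uniq_word s :
  commuting (mem s) ->
  exists t, [/\ uniq t, {subset t <= s} & word_perm t = word_perm s].
Proof.
elim: s => [|i s IHs] comm; first by exists [::].
have [j k js ks|t [ut ts tw]] := IHs; first by apply: comm; rewrite inE ?js ?ks orbT.
have sub : {subset i :: t <= i :: s}.
  by move=> j; rewrite !inE => /predU1P[->|/ts->]; rewrite ?eqxx ?orbT.
have [it|it] := boolP (i \in t); last first.
  by exists (i :: t); split; rewrite //= ?it // !word_perm_cons tw.
exists (rem i t); rewrite rem_uniq //; split=> //.
  by move=> j /mem_rem jt; apply: sub; rewrite inE jt orbT.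
rewrite word_perm_cons -tw (@commuting_word_perm t (i :: rem i t)) ?perm_to_rem //.
  by rewrite word_perm_cons -mulgA simple_transp_sq mulg1.
by move=> j k jt kt; apply: comm; apply: sub; rewrite inE ?jt ?kt orbT.
Qed.

(** The order of enumeration is immaterial once the generators in [A] commute. *)
Definition set_perm (A : {set 'I_n.-1}) : 'S_n := word_perm (enum A).

Lemma set_perm_word s :
  commuting (mem s) -> uniq s -> word_perm s = set_perm [set i in s].
Proof.
move=> comm us; apply: commuting_word_perm => //.
by apply: uniq_perm; rewrite ?enum_uniq // => i; rewrite mem_enum inE.
Qed.

Lemma free_permP w : free_perm w <-> exists2 J : {set 'I_n.-1}, commuting (mem J) & w = set_perm J.
Proof.
split=> [[s comm ->]|[J comm ->]].
  have [t [ut ts <-]] := commuting_uniq_word comm.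
  have commt : commuting (mem t) by move=> i j /ts si /ts sj; apply: comm.
  exists [set i in t]; last exact: set_perm_word.
  by move=> i j; rewrite !inE; apply: commt.
by exists (enum J) => // i j; rewrite !mem_enum; apply: comm.
Qed.

Lemma set_perm_reduced A : reduced_decomp (set_perm A) (enum A).
Proof. by apply: uniq_reduced_decomp; apply: enum_uniq. Qed.

Lemma sub_commuting (A B : {set 'I_n.-1}) :
  A \subset B -> commuting (mem B) -> commuting (mem A).
Proof. by move=> /subsetP AB comm i j /AB iB /AB jB; apply: comm. Qed.

(** Listing [A] before [B :\: A] gives a reduced word of [set_perm B]. Conversely, every reduced
    word of it rearranges [enum B], including one that starts with [enum A]. *)
Lemma set_perm_leP (A B : {set 'I_n.-1}) :
  commuting (mem B) -> A \subset B <-> weak_le (set_perm A) (set_perm B).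
Proof.
move=> comm; split=> [AB|/weak_le_extend/(_ (set_perm_reduced A))[t red]].
  apply: (@weak_le_prefix _ _ (enum (B :\: A))).
  set t := _ ++ _; have pt : perm_eq (enum B) t.
    apply: uniq_perm; rewrite ?cat_uniq ?enum_uniq //=.
      by rewrite andbT; apply/hasPn => i; rewrite !mem_enum inE => /andP[].
    move=> i; rewrite mem_cat !mem_enum inE.
    by case: (boolP (i \in A)) => //= /(subsetP AB).
  have -> : set_perm B = word_perm t.
    by apply: commuting_word_perm pt => i j; rewrite !mem_enum; apply: comm.
  by apply: uniq_reduced_decomp; rewrite -(perm_uniq pt) enum_uniq.
have /perm_mem mB := uniq_reduced_perm_eq (enum_uniq B) red.
by apply/subsetP => i iA; rewrite -mem_enum mB mem_cat mem_enum iA.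
Qed.

Lemma weak_le_set_perm (J : {set 'I_n.-1}) u :
  commuting (mem J) -> weak_le u (set_perm J) ->
  exists2 A : {set 'I_n.-1}, A \subset J & u = set_perm A.
Proof.
move=> comm uJ; have [s redu] := exists_reduced u.
have [t red] := weak_le_extend uJ redu.
have pst := uniq_reduced_perm_eq (enum_uniq J) red.
have sJ : {subset s <= J}.
  by move=> i si; rewrite -mem_enum (perm_mem pst) mem_cat si.
have us : uniq s.
  by have := enum_uniq J; rewrite (perm_uniq pst) cat_uniq => /andP[].
exists [set i in s]; first by apply/subsetP => i; rewrite inE; apply: sJ.
rewrite -set_perm_word //; first by case: redu.
by move=> i j /sJ iJ /sJ jJ; apply: comm.
Qed.

(** The subsets of [J :\: K] index the interval through [K :|: A]. A singleton [K] serves the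
    intervals above generators, and the empty [K] serves the ideal. *)
Lemma boolean_set_perm_interval (K J : {set 'I_n.-1}) :
  commuting (mem J) -> K \subset J ->
  boolean_subposet (@weak_le n) (weak_interval (set_perm K) (set_perm J)).
Proof.
move=> comm KJ; pose I := {i | i \in J :\: K}.
pose g (A : {set I}) := K :|: val @: A.
have gJ A : g A \subset J.
  rewrite subUset KJ; apply/subsetP => _ /imsetP[x _ ->].
  by have := valP x; rewrite inE => /andP[].
have fle (A B : {set I}) :
    A \subset B <-> weak_le (set_perm (g A)) (set_perm (g B)).
  have leP := @set_perm_leP (g A) (g B) (sub_commuting (gJ B) comm).
  split=> [AB|/leP/subsetP gAB]; first by apply/leP; rewrite setUS ?imsetS.
  apply/subsetP => x xA; have := gAB (val x); rewrite !inE imset_f // orbT.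
  have := valP x; rewrite inE => /andP[/negPf-> _] /(_ isT).
  by rewrite mem_imset //; apply: val_inj.
exists I, (fun A => set_perm (g A)); split=> // [A B e|u].
  by apply/eqP; rewrite eqEsubset; apply/andP; split; apply/fle; rewrite e; apply: weak_le_refl.
split=> [[Ku uJ]|[A <-]]; last first.
  split; apply/set_perm_leP => //; last exact: subsetUl.
  exact: sub_commuting comm.
have [A AJ defu] := weak_le_set_perm comm uJ; rewrite {}defu {u} in Ku uJ *.
have KA : K \subset A by apply/set_perm_leP => //; apply: sub_commuting comm.
exists [set x | val x \in A]; congr set_perm; apply/setP => i; rewrite !inE.
have [/(subsetP KA)->//|iK] := boolP (i \in K).
apply/imsetP/idP => [[x] + ->|iA]; first by rewrite inE.
have iJK : i \in J :\: K by rewrite inE iK (subsetP AJ).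
by exists (Sub i iJK); rewrite ?inE.
Qed.

(** * Boolean ideals *)

(** The count is a sandwich: [size s] is at most [#|I|], the number of atoms, which is at most the
    number of distinct letters of [s]. Equality makes every letter an atom. *)
Lemma boolean_ideal_simple_le w s i :
  reduced_decomp w s -> boolean_subposet (@weak_le n) (weak_ideal w) ->
  i \in s -> weak_le (simple_transp i) w.
Proof.
move=> red [I [f [f_inj imf fle]]] si; have [sw _] := red.
have idf A : weak_le (f A) w by apply/imf; exists A.
have f1 : f set0 = 1.
  have [A fA] := (imf 1).1 (weak_le1 w).
  have : A \subset set0 by apply/fle; rewrite fA; apply: weak_le1.
  by rewrite subset0 => /eqP A0; rewrite -A0.
(* The first letter of a reduced word of [f [set x]] lies below this atom and differs from the
   bottom [f set0], so it is the atom itself. *)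
have atom (x : I) : exists2 k, k \in s & f [set x] = simple_transp k.
  have [[|k r] redx] := exists_reduced (f [set x]).
    case: redx => fx _; move: fx; rewrite word_perm_nil -f1 => /f_inj/setP/(_ x).
    by rewrite !inE eqxx.
  have kx : weak_le (simple_transp k) (f [set x]).
    by rewrite -word_perm1; apply: (@weak_le_prefix _ [:: k] r).
  have kw := weak_le_trans kx (idf _); exists k.
    exact: weak_le_simple_mem kw sw.
  have [A fA] := (imf _).1 kw; rewrite -fA; congr f.
  have : A \subset [set x] by apply/fle; rewrite fA.
  rewrite subset1 => /orP[/eqP->//|/eqP A0].
  move: fA; rewrite A0 f1 -word_perm_nil -word_perm1 => e.
  by have := uniq_word_perm_subset (isT : uniq [:: k]) (esym e) (mem_head _ _).
(* Successive prefixes of [s] strictly increase, so each new letter enlarges the corresponding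
   subset of [I]. *)
have chain t r : s = t ++ r -> exists2 A, f A = word_perm t & size t <= #|A|.
  elim/last_ind: t r => [|t k IHt] r; first by exists set0; rewrite ?word_perm_nil ?f1.
  rewrite cat_rcons => st; have [A fA szA] := IHt _ st.
  have redtk : reduced_decomp (word_perm (rcons t k)) (rcons t k).
    by apply: (@reduced_prefix w _ r); rewrite cat_rcons -st.
  have [B fB] : exists B, f B = word_perm (rcons t k).
    by apply/imf; apply: (@weak_le_prefix _ _ r); rewrite cat_rcons -st.
  exists B; rewrite // size_rcons; apply: leq_ltn_trans szA _.
  apply: proper_card; rewrite properEneq; apply/andP; split.
    apply/eqP => AB; case: redtk => _ /(_ t).
    by rewrite -fA AB fB size_rcons ltnn => /(_ erefl).
  by apply/fle; rewrite fA fB; apply: (@weak_le_prefix _ t [:: k]); rewrite cats1.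
have [B _ szB] := chain s [::] (esym (cats0 s)).
have sub : [set f [set x] | x : I] \subset [set simple_transp k | k in s].
  by apply/subsetP => _ /imsetP[x _ ->]; have [k ks ->] := atom x; apply: imset_f.
have : simple_transp i \in [set f [set x] | x : I].
  suff /eqP-> : [set f [set x] | x : I] == [set simple_transp k | k in s] by apply: imset_f.
  rewrite eqEcard sub (card_imset _ (inj_comp f_inj set1_inj)).
  apply: leq_trans (leq_imset_card _ _) _; apply: leq_trans (card_size _) _.
  by apply: leq_trans szB _; apply: max_card.
by case/imsetP => x _ ->.
Qed.

End Words.

Theorem corollary6p5 (n : nat) (w : 'S_n) :
  ((forall sigma : 'S_n, in_support w sigma -> boolean_weak_interval sigma w)
     <-> free_perm w)
  /\ (free_perm w <-> boolean_subposet (@weak_le n) (weak_ideal w)).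
Proof.
have [s red] := exists_reduced w.
split; split.
- move=> bool_w; apply: (free_perm_of_boolean red) => i si.
  have [|iw boolP] := bool_w (simple_transp i); first by exists s => //; apply: map_f.
  by split=> //; exists (weak_interval (simple_transp i) w).
- move=> /free_permP[J comm ->] _ [t redt /mapP[i it ->]].
  have iJ : [set i] \subset J.
    rewrite sub1set -mem_enum.
    by rewrite (perm_mem (uniq_reduced_perm_eq (enum_uniq J) redt)).
  have -> : simple_transp i = set_perm [set i] by rewrite /set_perm enum_set1 word_perm1.
  split; last exact: boolean_set_perm_interval.
  exact/set_perm_leP.
- move=> /free_permP[J comm ->].
  have [I [f [f_inj imf fle]]] := boolean_set_perm_interval comm (sub0set J).
  (* The interval above [set_perm set0], which is the identity, is the whole ideal. *)
  exists I, f; split=> // u; split=> [uJ|/imf[]//]; apply/imf; split=> //.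
  by rewrite /set_perm enum_set0 word_perm_nil; apply: weak_le1.
- move=> bool_w; apply: (free_perm_of_boolean red) => i si; split.
    exact: boolean_ideal_simple_le red bool_w si.
  by exists (weak_ideal w).
Qed.
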